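(* Let $k$ be a field, let $X$ be a commutative (associative, unital) $k$-algebra, and let $\lambda,\lambda'\in k$. Define $k$-linear maps $A,B,C,D: X\otimes X\to X\otimes X$ (tensor products over $k$) by $$A(a\otimes b)=\lambda\, 1\otimes ab+ab\otimes 1-b\otimes a,$$ $$B(a\otimes b)=C(a\otimes b)=1\otimes ab+ab\otimes 1-b\otimes a,$$ $$D(a\otimes b)=\lambda'\, 1\otimes ab+ab\otimes 1-b\otimes a$$ for all $a,b\in X$. Then $(A,B,C,D)$ is a Yang--Baxter system (of generalised reflection algebra type), that is, the following eight identities hold: $$[A,A,A]=0,\quad [D,D,D]=0,\quad [A,C,C]=0,\quad [D,B,B]=0,$$ $$[A,B^+,B^+]=0,\quad [D,C^+,C^+]=0,\quad [A,C,B^+]=0,\quad [D,B,C^+]=0.$$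
   Context: For a $k$-vector space $V$ and $k$-linear maps $R,S,T: V\otimes V\to V\otimes V$, the constant Yang--Baxter commutator is the linear map $[R,S,T]: V\otimes V\otimes V\to V\otimes V\otimes V$ given by $$[R,S,T]:=R_{12}S_{13}T_{23}-T_{23}S_{13}R_{12},$$ where products denote composition and, for a linear map $Y$ on $V\otimes V$, $Y_{ij}$ denotes $Y$ acting on the $i$-th and $j$-th tensor factors of $V\otimes V\otimes V$ and as the identity on the remaining factor. The map $P: V\otimes V\to V\otimes V$ is the flip $P(a\otimes b)=b\otimes a$, and $Y^+:=PYP$. Here $V=X$. *)

(* Defs.v *)
From HB Require Import structures.
From mathcomp Require Import all_boot all_algebra.
From mathcomp Require Import boolp.
From mathcomp.multinomials Require Import freeg.

Set Implicit Arguments.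
Unset Strict Implicit.
Unset Printing Implicit Defensive.

Import GRing.Theory.
Local Open Scope ring_scope.
Local Open Scope quotient_scope.

Section Tensor.
Variables (k : fieldType) (U V : lmodType k).

Local Notation free := {freeg (U * V)%type / k}.

(* The submodule of relations: tensor U V is the quotient of the free module
   on U * V by it. *)
Inductive tensor_rel : free -> Prop :=
| TensorRel0 : tensor_rel 0
| TensorRelP a x y : tensor_rel x -> tensor_rel y -> tensor_rel (a *: x + y)
| TensorRelL a u u' v :
    tensor_rel (<< (a *: u + u', v) >> - (a *: << (u, v) >> + << (u', v) >>))
| TensorRelR a u v v' :
    tensor_rel (<< (u, a *: v + v') >> - (a *: << (u, v) >> + << (u, v') >>)).

Definition tensor_pred : {pred free} := fun x => `[< tensor_rel x >].

Lemma tensor_predP x : reflect (tensor_rel x) (x \in tensor_pred).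
Proof. exact: asboolP. Qed.

Lemma tensor_pred_submod : submod_closed tensor_pred.
Proof.
split=> [|a x y /tensor_predP hx /tensor_predP hy]; apply/tensor_predP.
  exact: TensorRel0.
exact: TensorRelP.
Qed.

HB.instance Definition _ :=
  GRing.isSubmodClosed.Build k free tensor_pred tensor_pred_submod.

Definition tensor : Type := Quotient.quot tensor_pred.

HB.instance Definition _ := GRing.Zmodule.on tensor.

Definition tensor_pi (x : free) : tensor := \pi_(Quotient.quot tensor_pred) x.

Definition tensor_repr (t : tensor) : free :=
  repr (t : Quotient.quot tensor_pred).

Lemma tensor_reprK t : tensor_pi (tensor_repr t) = t.
Proof. exact: reprK. Qed.

Lemma tensor_pi_is_zmod : zmod_morphism tensor_pi.
Proof. by move=> x y; rewrite /tensor_pi raddfB. Qed.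

HB.instance Definition _ :=
  GRing.isZmodMorphism.Build free tensor tensor_pi tensor_pi_is_zmod.

Lemma tensor_piP x y : tensor_pi x = tensor_pi y <-> tensor_rel (x - y).
Proof.
split=> [h | h].
  by apply/tensor_predP; rewrite Quotient.idealrBE; apply/eqP.
by apply/eqP; rewrite -Quotient.idealrBE; apply/tensor_predP.
Qed.

Definition tensor_scale (a : k) (t : tensor) : tensor :=
  tensor_pi (a *: tensor_repr t).

Lemma tensor_scaleE a x : tensor_scale a (tensor_pi x) = tensor_pi (a *: x).
Proof.
apply/tensor_piP; rewrite -scalerBr -[_ *: _]addr0.
apply: TensorRelP; last exact: TensorRel0.
by apply/tensor_piP; rewrite tensor_reprK.
Qed.

Lemma tensor_scaleA a b t :
  tensor_scale a (tensor_scale b t) = tensor_scale (a * b) t.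
Proof. by rewrite -[t]tensor_reprK !tensor_scaleE scalerA. Qed.

Lemma tensor_scale1 : left_id 1 tensor_scale.
Proof. by move=> t; rewrite -[t]tensor_reprK tensor_scaleE scale1r. Qed.

Lemma tensor_scaleDr : right_distributive tensor_scale +%R.
Proof.
move=> a s t; rewrite -[s]tensor_reprK -[t]tensor_reprK -raddfD.
by rewrite !tensor_scaleE scalerDr raddfD.
Qed.

Lemma tensor_scaleDl t : {morph tensor_scale^~ t : a b / a + b}.
Proof.
by move=> a b; rewrite -[t]tensor_reprK !tensor_scaleE scalerDl raddfD.
Qed.

HB.instance Definition _ := GRing.Zmodule_isLmodule.Build k tensor
  tensor_scaleA tensor_scale1 tensor_scaleDr tensor_scaleDl.

Lemma tensor_piZ a x : tensor_pi (a *: x) = a *: tensor_pi x.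
Proof. exact/esym/tensor_scaleE. Qed.

Definition tens (u : U) (v : V) : tensor := tensor_pi << (u, v) >>.

Lemma tens_is_bilinear : bilinear_for *:%R *:%R tens.
Proof.
split=> [v a u u' | u a v v'] /=; rewrite /tens -tensor_piZ -raddfD.
  exact/tensor_piP/TensorRelL.
exact/tensor_piP/TensorRelR.
Qed.

HB.instance Definition _ :=
  bilinear_isBilinear.Build k U V tensor *:%R *:%R tens tens_is_bilinear.

Lemma tens_ind (P : tensor -> Prop) :
  P 0 -> (forall a u v t, P t -> P (a *: tens u v + t)) -> forall t, P t.
Proof.
move=> P0 PD t; rewrite -[t]tensor_reprK -[tensor_repr t]freeg_sumE.
elim: (dom _) => [|[u v] s IH]; first by rewrite big_nil raddf0.
rewrite big_cons raddfD /=.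
suff -> c : tensor_pi << c *g (u, v) >> = c *: tens u v by apply: PD.
rewrite -tensor_piZ; congr tensor_pi; apply/eqP/freeg_eqP => z.
by rewrite coeffZ !coeffU mul1r.
Qed.

Section Lift.
Variables (W : lmodType k) (f : {bilinear U -> V -> W}).

Let phi : free -> W := fglift (fun p => f p.1 p.2).

Let phiB x y : phi (x - y) = phi x - phi y.
Proof. exact: lift_is_additive. Qed.

Let phi0 : phi 0 = 0.
Proof. by rewrite -[0 in LHS](subrr 0) phiB subrr. Qed.

Let phiD x y : phi (x + y) = phi x + phi y.
Proof. by rewrite -[y in LHS]opprK -[- y]sub0r !phiB phi0 sub0r opprK. Qed.

Let phiZ a x : phi (a *: x) = a *: phi x.
Proof.
rewrite -[x]freeg_sumE; elim: (dom x) => [|z s IH].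
  by rewrite !big_nil scaler0 phi0 scaler0.
rewrite !big_cons scalerDr !phiD IH scalerDr; congr (_ + _).
have -> : a *: << coeff z x *g z >> = << a * coeff z x *g z >> :> free.
  by apply/eqP/freeg_eqP => w; rewrite coeffZ !coeffU mulrA.
by rewrite /phi !liftU scalerA.
Qed.

Let phi_rel x : tensor_rel x -> phi x = 0.
Proof.
elim=> [|a {}x y _ IHx _ IHy|a u u' v|a u v v']; first exact: phi0.
- by rewrite phiD phiZ IHx IHy scaler0 addr0.
- rewrite phiB phiD phiZ /phi !liftU /= !scale1r.
  by rewrite linearPl subrr.
- rewrite phiB phiD phiZ /phi !liftU /= !scale1r.
  by rewrite linearPr subrr.
Qed.

Definition tens_lift (t : tensor) : W := phi (tensor_repr t).

Let tens_liftE x : tens_lift (tensor_pi x) = phi x.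
Proof.
apply/eqP; rewrite -subr_eq0 -phiB; apply/eqP/phi_rel/tensor_piP.
exact: tensor_reprK.
Qed.

Lemma tens_lift_is_linear : linear tens_lift.
Proof.
move=> a s t; rewrite -[s]tensor_reprK -[t]tensor_reprK -tensor_piZ -raddfD.
by rewrite !tens_liftE phiD phiZ.
Qed.

HB.instance Definition _ :=
  GRing.isLinear.Build k tensor W *:%R tens_lift tens_lift_is_linear.

Lemma tens_liftU u v : tens_lift (tens u v) = f u v.
Proof. by rewrite tens_liftE /phi liftU scale1r. Qed.

End Lift.

Lemma tens_ext (W : lmodType k) (f g : {linear tensor -> W}) :
  (forall u v, f (tens u v) = g (tens u v)) -> f =1 g.
Proof.
move=> fg; elim/tens_ind => [|a u v t IH]; first by rewrite !linear0.
by rewrite !linearP fg IH.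
Qed.

End Tensor.

Arguments tensor {k} U V.
Arguments tens {k U V} u v.

Notation "U ⊗ V" := (tensor U V)
  (at level 40, left associativity).
Notation "u ⊗ₜ v" := (tens u v)
  (at level 40, left associativity) : ring_scope.

Section Functor.
Variable k : fieldType.
Implicit Types U V W : lmodType k.

Lemma tensPl U V a (u u' : U) (v : V) :
  (a *: u + u') ⊗ₜ v = a *: (u ⊗ₜ v) + u' ⊗ₜ v.
Proof. exact: linearPl. Qed.

Lemma tensPr U V a (u : U) (v v' : V) :
  u ⊗ₜ (a *: v + v') = a *: (u ⊗ₜ v) + u ⊗ₜ v'.
Proof. exact: linearPr. Qed.

Definition tens_map_fun U V U' V' (f : U -> U') (g : V -> V') (u : U) (v : V) :
  U' ⊗ V' := f u ⊗ₜ g v.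

Lemma tens_map_fun_bilinear U V U' V'
    (f : {linear U -> U'}) (g : {linear V -> V'}) :
  bilinear_for *:%R *:%R (tens_map_fun f g).
Proof.
by split=> [v a u u' | u a v v']; rewrite /tens_map_fun linearP (linearPl, linearPr).
Qed.

HB.instance Definition _ U V U' V'
    (f : {linear U -> U'}) (g : {linear V -> V'}) :=
  bilinear_isBilinear.Build k U V (U' ⊗ V') *:%R *:%R (tens_map_fun f g)
    (tens_map_fun_bilinear f g).

Definition tens_map U V U' V' (f : {linear U -> U'}) (g : {linear V -> V'}) :
  {linear U ⊗ V -> U' ⊗ V'} := tens_lift (tens_map_fun f g).

Lemma tens_mapE U V U' V' (f : {linear U -> U'}) (g : {linear V -> V'}) u v :
  tens_map f g (u ⊗ₜ v) = f u ⊗ₜ g v.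
Proof. exact: tens_liftU. Qed.

Definition tens_flip_fun U V (u : U) (v : V) : V ⊗ U := v ⊗ₜ u.

Lemma tens_flip_fun_bilinear U V : bilinear_for *:%R *:%R (@tens_flip_fun U V).
Proof.
by split=> [v a u u' | u a v v']; rewrite /tens_flip_fun (linearPl, linearPr).
Qed.

HB.instance Definition _ U V :=
  bilinear_isBilinear.Build k U V (V ⊗ U) *:%R *:%R (@tens_flip_fun U V)
    (tens_flip_fun_bilinear U V).

Definition tens_flip U V : {linear U ⊗ V -> V ⊗ U} :=
  tens_lift (@tens_flip_fun U V).

Lemma tens_flipE U V u v : tens_flip U V (u ⊗ₜ v) = v ⊗ₜ u.
Proof. exact: tens_liftU. Qed.

(* The associator (u ⊗ₜ v) ⊗ₜ w |-> u ⊗ₜ (v ⊗ₜ w) and its inverse. *)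
Definition tens_by V W (w : W) (v : V) : V ⊗ W := v ⊗ₜ w.

Lemma tens_by_linear V W (w : W) : linear (@tens_by V W w).
Proof. by move=> a v v'; rewrite /tens_by tensPl. Qed.

HB.instance Definition _ V W (w : W) :=
  GRing.isLinear.Build k V (V ⊗ W) *:%R (@tens_by V W w)
    (tens_by_linear w).

Definition tens_with U V (u : U) (v : V) : U ⊗ V := u ⊗ₜ v.

Lemma tens_with_linear U V (u : U) : linear (@tens_with U V u).
Proof. by move=> a v v'; rewrite /tens_with tensPr. Qed.

HB.instance Definition _ U V (u : U) :=
  GRing.isLinear.Build k V (U ⊗ V) *:%R (@tens_with U V u)
    (tens_with_linear u).

Definition tens_assoc_fun U V W (t : U ⊗ V) (w : W) : U ⊗ (V ⊗ W) :=
  tens_map idfun (@tens_by V W w) t.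

Lemma tens_assoc_fun_bilinear U V W :
  bilinear_for *:%R *:%R (@tens_assoc_fun U V W).
Proof.
split=> [w a s t | t a w w'] /=; rewrite /tens_assoc_fun ?linearP //.
elim/tens_ind: t => [|b u v t IH]; first by rewrite !linear0 ?scaler0 addr0.
rewrite !linearP IH !tens_mapE /= /tens_by !tensPr.
by rewrite scalerDr addrACA.
Qed.

HB.instance Definition _ U V W :=
  bilinear_isBilinear.Build k (U ⊗ V) W (U ⊗ (V ⊗ W)) *:%R *:%R
    (@tens_assoc_fun U V W) (tens_assoc_fun_bilinear U V W).

Definition tens_assoc U V W : {linear U ⊗ V ⊗ W -> U ⊗ (V ⊗ W)} :=
  tens_lift (@tens_assoc_fun U V W).

Lemma tens_assocE U V W u v w : tens_assoc U V W (u ⊗ₜ v ⊗ₜ w) = u ⊗ₜ (v ⊗ₜ w).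
Proof. by rewrite [LHS]tens_liftU [LHS]tens_mapE. Qed.

Definition tens_assocV_fun U V W (u : U) (t : V ⊗ W) : U ⊗ V ⊗ W :=
  tens_map (@tens_with U V u) idfun t.

Lemma tens_assocV_fun_bilinear U V W :
  bilinear_for *:%R *:%R (@tens_assocV_fun U V W).
Proof.
split=> [t a u u' | u a s t] /=; rewrite /tens_assocV_fun ?linearP //.
elim/tens_ind: t => [|b v w t IH]; first by rewrite !linear0 ?scaler0 addr0.
rewrite !linearP IH !tens_mapE /= /tens_with !tensPl.
by rewrite scalerDr addrACA.
Qed.

HB.instance Definition _ U V W :=
  bilinear_isBilinear.Build k U (V ⊗ W) (U ⊗ V ⊗ W) *:%R *:%R
    (@tens_assocV_fun U V W) (tens_assocV_fun_bilinear U V W).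

Definition tens_assocV U V W : {linear U ⊗ (V ⊗ W) -> U ⊗ V ⊗ W} :=
  tens_lift (@tens_assocV_fun U V W).

Lemma tens_assocVE U V W u v w :
  tens_assocV U V W (u ⊗ₜ (v ⊗ₜ w)) = u ⊗ₜ v ⊗ₜ w.
Proof. by rewrite [LHS]tens_liftU [LHS]tens_mapE. Qed.

Lemma tens3_ext U V W (M : lmodType k) (f g : {linear U ⊗ V ⊗ W -> M}) :
  (forall u v w, f (u ⊗ₜ v ⊗ₜ w) = g (u ⊗ₜ v ⊗ₜ w)) -> f =1 g.
Proof.
move=> fg; apply: tens_ext => t w.
have -> : t ⊗ₜ w = @tens_by _ _ w t by [].
elim/tens_ind: t => [|a u v t IH]; first by rewrite !linear0.
by rewrite !linearP /= IH /tens_by fg.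
Qed.

End Functor.

Section YangBaxter.
Variables (k : fieldType) (V : lmodType k).
Implicit Types R S T Y A B C D : {linear V ⊗ V -> V ⊗ V}.

Definition flip : {linear V ⊗ V -> V ⊗ V} := tens_flip V V.

Definition leg12 Y : {linear V ⊗ V ⊗ V -> V ⊗ V ⊗ V} := tens_map Y idfun.

Definition leg23 Y : {linear V ⊗ V ⊗ V -> V ⊗ V ⊗ V} :=
  tens_assocV V V V \o tens_map idfun Y \o tens_assoc V V V.

(* Y acts on factors 1 and 3 once factors 2 and 3 have been exchanged. *)
Definition leg13 Y : {linear V ⊗ V ⊗ V -> V ⊗ V ⊗ V} :=
  leg23 flip \o leg12 Y \o leg23 flip.

Lemma flipE u v : flip (u ⊗ₜ v) = v ⊗ₜ u.
Proof. exact: tens_flipE. Qed.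

Lemma leg12E Y u v w : leg12 Y (u ⊗ₜ v ⊗ₜ w) = Y (u ⊗ₜ v) ⊗ₜ w.
Proof. exact: tens_mapE. Qed.

Lemma leg23E Y u v w :
  leg23 Y (u ⊗ₜ v ⊗ₜ w) = tens_assocV V V V (u ⊗ₜ Y (v ⊗ₜ w)).
Proof. by rewrite /leg23 /comp /= tens_assocE tens_mapE. Qed.

Lemma leg23_flipE u v w : leg23 flip (u ⊗ₜ v ⊗ₜ w) = u ⊗ₜ w ⊗ₜ v.
Proof. by rewrite leg23E flipE tens_assocVE. Qed.

Lemma leg13E Y u v w :
  leg13 Y (u ⊗ₜ v ⊗ₜ w) = leg23 flip (Y (u ⊗ₜ w) ⊗ₜ v).
Proof.
rewrite -[LHS]/(leg23 flip (leg12 Y (leg23 flip (u ⊗ₜ v ⊗ₜ w)))).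
by rewrite leg23_flipE leg12E.
Qed.

Definition YBcomm R S T : {linear V ⊗ V ⊗ V -> V ⊗ V ⊗ V} :=
  (leg12 R \o leg13 S \o leg23 T) \- (leg23 T \o leg13 S \o leg12 R).

Definition flip_conj Y : {linear V ⊗ V -> V ⊗ V} := flip \o Y \o flip.

Definition YB_system A B C D : Prop :=
  [/\ YBcomm A A A =1 \0, YBcomm D D D =1 \0,
      YBcomm A C C =1 \0 & YBcomm D B B =1 \0] /\
  [/\ YBcomm A (flip_conj B) (flip_conj B) =1 \0,
      YBcomm D (flip_conj C) (flip_conj C) =1 \0,
      YBcomm A C (flip_conj B) =1 \0 &
      YBcomm D B (flip_conj C) =1 \0].

End YangBaxter.

(* A commutative k-algebra is a commutative ring X with a ring morphism
   eta : k -> X, and kalg eta is X with the scaling a *: x = eta a * x.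
   Unlike comAlgType, this includes the zero algebra. *)
Definition kalg (k : fieldType) (X : comPzRingType) (eta : {rmorphism k -> X})
  : Type := X.

Section KAlgebra.
Variables (k : fieldType) (X : comPzRingType) (eta : {rmorphism k -> X}).

HB.instance Definition _ := GRing.ComPzRing.on (kalg eta).

Definition kalg_scale (a : k) (x : kalg eta) : kalg eta := eta a * x.

Lemma kalg_scaleA a b x : kalg_scale a (kalg_scale b x) = kalg_scale (a * b) x.
Proof. by rewrite /kalg_scale rmorphM mulrA. Qed.

Lemma kalg_scale1 : left_id 1 kalg_scale.
Proof. by move=> x; rewrite /kalg_scale rmorph1 mul1r. Qed.

Lemma kalg_scaleDr : right_distributive kalg_scale +%R.
Proof. by move=> a x y; rewrite /kalg_scale mulrDr. Qed.

Lemma kalg_scaleDl x : {morph kalg_scale^~ x : a b / a + b}.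
Proof. by move=> a b; rewrite /kalg_scale rmorphD mulrDl. Qed.

HB.instance Definition _ := GRing.Zmodule_isLmodule.Build k (kalg eta)
  kalg_scaleA kalg_scale1 kalg_scaleDr kalg_scaleDl.

Lemma kalg_scaleE (a : k) (x : kalg eta) : a *: x = eta a * x.
Proof. by []. Qed.

End KAlgebra.

Lemma kalg_in_alg (k : fieldType) (X : comAlgType k) (a : k) (x : X) :
  a *: (x : kalg (in_alg X)) = a *: x.
Proof. by rewrite kalg_scaleE /= mulr_algl. Qed.

(* A linear map with yb_mapE exists for every l, including l = 1. *)
Section YBMap.
Variables (k : fieldType) (X : comPzRingType) (eta : {rmorphism k -> X}).
Variable l : k.

Definition yb_map_fun (a b : kalg eta) : kalg eta ⊗ kalg eta :=
  l *: ((1 : kalg eta) ⊗ₜ (a * b)) + (a * b) ⊗ₜ (1 : kalg eta) - b ⊗ₜ a.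

Lemma yb_map_fun_bilinear : bilinear_for *:%R *:%R yb_map_fun.
Proof.
have SD (c : k) (p q r p' q' r' : kalg eta ⊗ kalg eta) :
    l *: (c *: p + p') + (c *: q + q') - (c *: r + r') =
    c *: (l *: p + q - r) + (l *: p' + q' - r').
  rewrite scalerBr !scalerDr !scalerA (mulrC l c) opprD.
  by rewrite [X in X + (- _ - _)]addrACA [LHS]addrACA.
split=> [b c a a' | a c b b'] /=; rewrite /yb_map_fun.
  have -> : (c *: a + a') * b = c *: (a * b) + a' * b :> kalg eta.
    by rewrite mulrDl !kalg_scaleE mulrA.
  by rewrite !tensPl !tensPr SD.
have -> : a * (c *: b + b') = c *: (a * b) + a * b' :> kalg eta.
  by rewrite mulrDr !kalg_scaleE mulrCA.
by rewrite !tensPl !tensPr SD.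
Qed.

HB.instance Definition _ :=
  bilinear_isBilinear.Build k (kalg eta) (kalg eta) (kalg eta ⊗ kalg eta)
    *:%R *:%R yb_map_fun yb_map_fun_bilinear.

Definition yb_map : {linear kalg eta ⊗ kalg eta -> kalg eta ⊗ kalg eta} :=
  tens_lift yb_map_fun.

Lemma yb_mapE (a b : kalg eta) :
  yb_map (a ⊗ₜ b) = l *: ((1 : kalg eta) ⊗ₜ (a * b)) + (a * b) ⊗ₜ (1 : kalg eta) - b ⊗ₜ a.
Proof. exact: tens_liftU. Qed.

End YBMap.

(* Main.v *)
(* All eight commutators have the form [R, S, S] with R(a⊗b) = p 1⊗ab + ab⊗1 - b⊗a
   and S of the same shape with parameter s: since X is commutative, the maps
   with parameter 1 satisfy Y^+ = Y. Both triple products send a⊗b⊗c to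
     ps(s 1⊗1⊗abc + 1⊗abc⊗1 - 1⊗c⊗ab) + s(abc⊗1⊗1 - 1⊗abc⊗1)
       + s(1⊗bc⊗a - bc⊗1⊗a) - bc⊗a⊗1 + bc⊗1⊗a + c⊗ab⊗1 - c⊗b⊗a. *)
Require Import Defs.
From HB Require Import structures.
From mathcomp Require Import all_boot all_algebra ring.

Set Implicit Arguments.
Unset Strict Implicit.
Unset Printing Implicit Defensive.

Import GRing.Theory.
Local Open Scope ring_scope.

Lemma tensBl (k : fieldType) (U V : lmodType k) (u u' : U) (v : V) :
  (u - u') ⊗ₜ v = u ⊗ₜ v - u' ⊗ₜ v.
Proof. exact: linearBl. Qed.

Lemma tensBr (k : fieldType) (U V : lmodType k) (u : U) (v v' : V) :
  u ⊗ₜ (v - v') = u ⊗ₜ v - u ⊗ₜ v'.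
Proof. exact: linearBr. Qed.

Section PolyInterp.
Variables (k : fieldType) (M : lmodType k) (t : seq M).

Definition poly_interp (P : {poly k}) : M := \sum_(i < size t) P`_i *: t`_i.

Lemma poly_interp_is_linear : linear poly_interp.
Proof.
move=> c P Q; rewrite /poly_interp scaler_sumr -big_split /=.
by apply: eq_bigr => i _; rewrite coefD coefZ scalerDl scalerA.
Qed.

HB.instance Definition _ :=
  GRing.isLinear.Build k {poly k} M *:%R poly_interp poly_interp_is_linear.

Lemma poly_interpXn n : poly_interp 'X^n = t`_n.
Proof.
rewrite /poly_interp; case: (ltnP n (size t)) => [lt_n|ge_n].
  rewrite (bigD1 (Ordinal lt_n)) //= coefXn eqxx scale1r big1 ?addr0 // => i.
  by rewrite -val_eqE /= coefXn => /negPf ->; rewrite scale0r.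
(* Past the end of [t] both sides vanish: the default of the [nth] is 0, and no summation index
   equals [n]. *)
rewrite nth_default // big1 // => i _; rewrite coefXn.
by rewrite ltn_eqF ?scale0r // (leq_trans (ltn_ord i)).
Qed.

End PolyInterp.

(** The existential keeps [t] out of sight: once [phi] is abstract, entries of [t] can be rewritten
    as values of [phi] without altering [phi] itself. *)
Lemma linear_poly_interp (k : fieldType) (M : lmodType k) (t : seq M) :
  exists phi : {linear {poly k} -> M}, forall n, phi 'X^n = t`_n.
Proof. by exists (poly_interp t); apply: poly_interpXn. Qed.

(* Monomials are free, so a linear identity between vectors may be checked by
   [ring] after replacing the vectors by distinct powers of 'X. *)
Lemma YB_expansions_agree (k : fieldType) (M : lmodType k) (p s : k)
    (x0 x1 x2 x3 x4 x5 x6 x7 x8 x9 : M) :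
  s *: (s *: (p *: x0) + (p *: x1 + x2 - x1) - (p *: x3 + x4 - x3)) +
  (s *: (p *: x3) + (p *: x1 + x2 - x5) - p *: x3) -
  (s *: (p *: x6) + (p *: x1 + x2 - x8) - (p *: x3 + x4 - x9)) =
  p *: (s *: (s *: x0 + x1 - x6)) + (s *: (s *: x0) + s *: x2 - s *: x7) -
  (s *: (s *: x0 + x1 - x3) + (s *: x4 + x5 - x4) - (s *: x7 + x8 - x9)).
Proof.
have [phi phiX] :=
  linear_poly_interp [:: x0; x1; x2; x3; x4; x5; x6; x7; x8; x9].
rewrite -[x0](phiX 0) -[x1](phiX 1) -[x2](phiX 2) -[x3](phiX 3) -[x4](phiX 4).
rewrite -[x5](phiX 5) -[x6](phiX 6) -[x7](phiX 7) -[x8](phiX 8) -[x9](phiX 9).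
rewrite -!(linearZ_LR phi, linearB phi, linearD phi).
congr (phi _).
(* Scalars become constant polynomials, leaving an identity in the commutative ring [{poly k}]. *)
by rewrite -!mul_polyC; ring.
Qed.

Lemma linearZDB (k : fieldType) (M N : lmodType k) (f : {linear M -> N})
    (p : k) (x y z : M) :
  f (p *: x + y - z) = p *: f x + f y - f z.
Proof. by rewrite linearB linearP. Qed.

Section YangBaxterMaps.
Variables (k : fieldType) (X : comPzRingType) (eta : {rmorphism k -> X}).
Local Notation V := (kalg eta).
Local Notation e := (1 : V).
Implicit Types (p s : k) (Y R S T : {linear V ⊗ V -> V ⊗ V}) (u v w a b c : V).

Definition has_yb_form p Y := forall a b, Y (a ⊗ₜ b) = yb_map_fun p a b.

Lemma leg12_yb p Y u v w : has_yb_form p Y ->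
  leg12 Y (u ⊗ₜ v ⊗ₜ w) =
  p *: (e ⊗ₜ (u * v) ⊗ₜ w) + (u * v) ⊗ₜ e ⊗ₜ w - v ⊗ₜ u ⊗ₜ w.
Proof. by move=> hY; rewrite leg12E hY /yb_map_fun tensBl tensPl. Qed.

Lemma leg23_yb p Y u v w : has_yb_form p Y ->
  leg23 Y (u ⊗ₜ v ⊗ₜ w) =
  p *: (u ⊗ₜ e ⊗ₜ (v * w)) + u ⊗ₜ (v * w) ⊗ₜ e - u ⊗ₜ w ⊗ₜ v.
Proof.
move=> hY; rewrite leg23E hY /yb_map_fun tensBr tensPr.
by rewrite linearB linearP !tens_assocVE.
Qed.

Lemma leg13_yb p Y u v w : has_yb_form p Y ->
  leg13 Y (u ⊗ₜ v ⊗ₜ w) =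
  p *: (e ⊗ₜ v ⊗ₜ (u * w)) + (u * w) ⊗ₜ v ⊗ₜ e - w ⊗ₜ v ⊗ₜ u.
Proof.
move=> hY; rewrite leg13E hY /yb_map_fun tensBl tensPl linearB linearP.
by rewrite !leg23_flipE.
Qed.

(** The flip exchanges 1⊗ba and ba⊗1, which have equal coefficients at parameter 1. *)
Lemma flip_conj_yb Y : has_yb_form 1 Y -> has_yb_form 1 (flip_conj Y).
Proof.
move=> hY a b; rewrite -[LHS]/(flip V (Y (flip V (a ⊗ₜ b)))) flipE hY.
rewrite linearB linearP !flipE /yb_map_fun !scale1r [b * a]mulrC.
by congr (_ - _); apply: addrC.
Qed.

(** [S] and [T] share a parameter but remain separate maps, so that [A, C, B^+] and [D, B, C^+] are
    covered too. *)
Lemma YBcomm_yb p s R S T : has_yb_form p R -> has_yb_form s S ->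
  has_yb_form s T -> YBcomm R S T =1 \0.
Proof.
move=> hR hS hT; apply: tens3_ext => a b c.
rewrite -[LHS]/(leg12 R (leg13 S (leg23 T (a ⊗ₜ b ⊗ₜ c))) -
  leg23 T (leg13 S (leg12 R (a ⊗ₜ b ⊗ₜ c)))) -[RHS]/0.
apply/eqP; rewrite subr_eq0; apply/eqP.
rewrite (leg12_yb _ _ _ hR) (leg23_yb _ _ _ hT) !(linearZDB (leg13 S)).
(* [addrK] uses S(1⊗v) = s 1⊗v + v⊗1 - v⊗1 = s 1⊗v; the same cancellation recurs below for [R] and
   [T]. *)
rewrite !(leg13_yb _ _ _ hS) !(mul1r, mulr1) !addrK mulrA.
rewrite !(linearZDB (leg12 R), linearZDB (leg23 T)).
rewrite !(linearZ_LR (leg12 R), linearZ_LR (leg23 T)).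
rewrite !(leg12_yb _ _ _ hR, leg23_yb _ _ _ hT) !(mul1r, mulr1) !addrK mulrA.
(* The vectors [x0] to [x9] are, in order, 1⊗1⊗abc, 1⊗abc⊗1, abc⊗1⊗1, 1⊗bc⊗a, bc⊗1⊗a, bc⊗a⊗1,
   1⊗c⊗ab, c⊗1⊗ab, c⊗ab⊗1, c⊗b⊗a. *)
exact: YB_expansions_agree.
Qed.

End YangBaxterMaps.

Theorem theorem2p1 (k : fieldType) (X : comPzRingType)
    (eta : {rmorphism k -> X}) (l l' : k)
    (A B C D : {linear kalg eta ⊗ kalg eta -> kalg eta ⊗ kalg eta})
    (hA : forall a b : kalg eta,
        A (a ⊗ₜ b) = l *: ((1 : kalg eta) ⊗ₜ (a * b)) + (a * b) ⊗ₜ (1 : kalg eta) - b ⊗ₜ a)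
    (hB : forall a b : kalg eta,
        B (a ⊗ₜ b) = (1 : kalg eta) ⊗ₜ (a * b) + (a * b) ⊗ₜ (1 : kalg eta) - b ⊗ₜ a)
    (hC : forall a b : kalg eta,
        C (a ⊗ₜ b) = (1 : kalg eta) ⊗ₜ (a * b) + (a * b) ⊗ₜ (1 : kalg eta) - b ⊗ₜ a)
    (hD : forall a b : kalg eta,
        D (a ⊗ₜ b) = l' *: ((1 : kalg eta) ⊗ₜ (a * b)) + (a * b) ⊗ₜ (1 : kalg eta) - b ⊗ₜ a) :
  YB_system A B C D.
Proof.
have B1 : has_yb_form 1 B by move=> a b; rewrite hB /yb_map_fun scale1r.
have C1 : has_yb_form 1 C by move=> a b; rewrite hC /yb_map_fun scale1r.
have [Bp Cp] := (flip_conj_yb B1, flip_conj_yb C1).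
have Al : has_yb_form l A by [].
have Dl : has_yb_form l' D by [].
split; split.
- exact: (YBcomm_yb Al Al Al).
- exact: (YBcomm_yb Dl Dl Dl).
- exact: (YBcomm_yb Al C1 C1).
- exact: (YBcomm_yb Dl B1 B1).
- exact: (YBcomm_yb Al Bp Bp).
- exact: (YBcomm_yb Dl Cp Cp).
- exact: (YBcomm_yb Al C1 Bp).
- exact: (YBcomm_yb Dl B1 Cp).
Qed.
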